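(* Let $\alpha\ge1$. For $\tau>0$ let $R_2(\tau):=\|Av_\tau-f\|_{\mathcal H}$, where $v_\tau$ is a minimizer of $E_\tau^{2,1}(\cdot;f)$. The map $$T:(0,\infty)\to(0,\infty),\qquad \tau\mapsto T(\tau):=\tau R_2(\tau)^{\alpha-2}$$ is well-defined, non-decreasing, and surjective. If $\alpha>1$, it is even a bijection with continuous inverse $S(t):=t\,R_\alpha(t)^{2-\alpha}$, where $R_\alpha(t):=\|Au_t-f\|_{\mathcal H}$ and $u_t$ is a minimizer of $E_t^{\alpha,1}(\cdot;f)$.
   Context: Setting: $\mathcal X$ is the (real) Banach space dual of a separable Banach space $\mathcal Y$; $\mathcal H$ is a real Hilbert space; $A:\mathcal X\to\mathcal H$ is bounded and linear. $J:\mathcal X\to[0,\infty]$ is convex, proper, weak$^*$ lower semi-continuous and absolutely one-homogeneous ($J(cu)=|c|J(u)$). $\mathcal N(J)=\{u:J(u)=0\}$. The datum $f\in\mathcal H$ is such that any $u\in\mathcal X$ with $Au=f$ satisfies $J(u)\ne 0$. $E_t^{\alpha,1}(u;f)=\frac1\alpha\|Au-f\|_{\mathcal H}^\alpha+tJ(u)$ for $u\in\mathcal X$, $t>0$. For $\alpha>1$, the residual $\|Au_t-f\|_{\mathcal H}$ does not depend on the choice of minimizer $u_t$ of $E_t^{\alpha,1}(\cdot;f)$. Standing assumptions: (1) $u\mapsto\|Au\|_{\mathcal H}$ is a norm on $\mathcal N(J)$ equivalent to the restriction of $\|\cdot\|_{\mathcal X}$. (2) There is $C>0$ with $\|u-\mathcal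 P^A(Au)\|_{\mathcal X}\le C J(u)$ for all $u\in\mathcal X$, where $\mathcal P^A(g)$ denotes the (unique) minimizer of $\|Au-g\|_{\mathcal H}$ over $u\in\mathcal N(J)$, $g\in\mathcal H$. (3) $A$ is weak$^*$-to-weak continuous.
   Formalization: For α=1 surjectivity of T onto (0,∞) is false (X=H=ℝ, A=id, J=|·|, f=1 gives T(τ)=max(τ,1)); T is instead shown onto those t>0 for which some minimizer of E_t^{α,1} has nonzero residual. For α>1 the claim is in full. *)

(* Defs.v *)
From HB Require Import structures.
From mathcomp Require Import all_boot all_order all_algebra.
From mathcomp Require Import all_classical all_reals all_analysis.

Set Implicit Arguments.
Unset Strict Implicit.
Unset Printing Implicit Defensive.

Import Order.TTheory GRing.Theory Num.Theory.
Import numFieldNormedType.Exports.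

Local Open Scope classical_set_scope.
Local Open Scope ring_scope.

Section Spaces.
Context {R : realType}.

Definition separable (T : topologicalType) : Prop :=
  exists D : set T, countable D /\ dense D.

(* [X] is the dual of [Y]: through [b], it is isometrically isomorphic to the
   space of continuous linear functionals on [Y] with the operator norm. *)
Record is_dual (X Y : normedModType R) (b : {bilinear X -> Y -> R^o}) : Prop :=
  IsDual {
    dual_continuous : forall u : X, continuous (b u : Y -> R^o);
    dual_norm : forall u : X,
      `|u| = sup [set `|b u y| | y in [set y : Y | `|y| <= 1]];
    dual_surjective : forall phi : {linear Y -> R^o}, continuous phi ->
      exists u : X, forall y : Y, b u y = phi y }.

(* The coarsest topology making every evaluation [b ^~ y] continuous. *)
Definition weak_star (X Y : normedModType R) (b : {bilinear X -> Y -> R^o}) :=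
  initial_topology (fun u : X => (fun y : Y => b u y) : {ptws Y -> R^o}).

Definition weak (V : normedModType R) :=
  initial_topology
    (fun v : V => (fun phi => sval phi v) :
       {ptws {phi : {linear V -> R^o} | continuous phi} -> R^o}).

(* Stated through [weak_star b] because [X] itself carries its norm topology. *)
Definition weak_star_lsc (X Y : normedModType R)
    (b : {bilinear X -> Y -> R^o}) (J : X -> \bar R) : Prop :=
  @lower_semicontinuous (weak_star b) R J.

Definition weak_star_to_weak_continuous (X Y V : normedModType R)
    (b : {bilinear X -> Y -> R^o}) (A : X -> V) : Prop :=
  continuous (A : weak_star b -> weak V).

Definition is_hilbert (H : completeNormedModType R) (ip : {dot H for idfun}) :
  Prop := forall h : H, `|h| ^+ 2 = ip h h.

Definition is_norm_on (V : lmodType R) (N : set V) (p : V -> R) : Prop :=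
  [/\ forall u v, N u -> N v -> p (u + v) <= p u + p v,
      forall (c : R) u, N u -> p (c *: u) = `|c| * p u &
      forall u, N u -> p u = 0 -> u = 0].

Definition equivalent_on (V : Type) (N : set V) (p q : V -> R) : Prop :=
  exists c C : R, [/\ 0 < c, 0 < C &
    forall u, N u -> c * q u <= p u /\ p u <= C * q u].

End Spaces.

Section Functionals.
Context {R : realType} {X : lmodType R}.
Implicit Types J : X -> \bar R.
Local Open Scope ereal_scope.

Definition econvex J : Prop :=
  forall (u v : X) (l : R), (0 <= l <= 1)%R ->
    J (l *: u + (1 - l) *: v)%R <= l%:E * J u + (1 - l)%:E * J v.

Definition eproper J : Prop := exists u : X, J u < +oo.

Definition abs_one_homogeneous J : Prop :=
  forall (c : R) (u : X), J (c *: u)%R = `|c|%:E * J u.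

Definition nullset J : set X := [set u | J u = 0].

End Functionals.

Section Variational.
Context {R : realType} {X H : normedModType R}.
Variables (A : X -> H) (J : X -> \bar R).

Definition PA_minimizers (g : H) : set X :=
  [set u | nullset J u /\
           forall w, nullset J w -> `|A u - g| <= `|A w - g|].

Definition PA (g : H) : X := xget 0 (PA_minimizers g).

Variable f : H.

Definition energy (alpha t : R) (u : X) : \bar R :=
  ((alpha^-1 * `|A u - f| `^ alpha)%:E + t%:E * J u)%E.

Definition minimizers (alpha t : R) : set X :=
  [set u | forall w : X, (energy alpha t u <= energy alpha t w)%E].

Definition residual_well_defined (alpha t : R) : Prop :=
  minimizers alpha t !=set0 /\
  forall u v, minimizers alpha t u -> minimizers alpha t v ->
    `|A u - f| = `|A v - f|.

(* Meaningful only when [residual_well_defined alpha t]; the minimizer is then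
   arbitrary. *)
Definition residual (alpha t : R) : R :=
  `|A (xget 0 (minimizers alpha t)) - f|.

Definition Tmap (alpha tau : R) : R := tau * residual 2 tau `^ (alpha - 2).

Definition Smap (alpha t : R) : R := t * residual alpha t `^ (2 - alpha).

(* For [1 < alpha], under the standing assumptions, this is all of `]0, +oo[.
   For [alpha = 1] it can be smaller (exact penalization): with X = H = R,
   A = id, J = |.| and f = 1 one has residual 2 tau = min(tau, 1), hence
   Tmap 1 tau = max(tau, 1), and this set is `[1, +oo[. *)
Definition inexact_parameters (alpha : R) : set R :=
  [set t | 0 < t /\ exists2 u, minimizers alpha t u & `|A u - f| != 0].

End Variational.

(* Main.v *)
Require Import Defs.
From HB Require Import structures.
From mathcomp Require Import all_boot all_order all_algebra.
From mathcomp Require Import all_classical all_reals all_analysis.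
From mathcomp Require Import ring lra.

Set Implicit Arguments.
Unset Strict Implicit.
Unset Printing Implicit Defensive.

Import Order.TTheory GRing.Theory Num.Theory.
Import numFieldNormedType.Exports.

Local Open Scope classical_set_scope.
Local Open Scope ring_scope.

(** Write d(u) = `|A u - f|.  The map T is the dictionary between the
exponents: if u minimizes d ^ 2 / 2 + tau J and has residual r > 0, then u
also minimizes d ^ alpha / alpha + T(tau) J.

Indeed d and J are convex, so for r > 0 the point u minimizes
d ^ a / a + t J if and only if the first-order inequality
r ^ (a - 1) (d(w) - r) + t (J(w) - J(u)) >= 0 holds for every w: necessity
by moving from u towards w, sufficiency by the tangent inequality for
x ^ a / a.  Dividing by r ^ (a - 1), this says that u minimizes
d + t r ^ (1 - a) J, a condition in which a survives only through the weight.
Going from a to 1 and back to c turns the pair (a, t) into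
(c, t r ^ (c - a)) with the same minimizer ([argmin_exponent]).

Everything about T and S follows from this exchange together with one
elementary monotonicity ([argmin_residual_le]): for a fixed exponent, a larger
weight on J does not give a smaller residual.
- For a > 1 minimizers have r > 0 ([argmin_residual_gt0]).  Two minimizers for
  the same (a, t) with different residuals would minimize d + c J for weights c
  ordered the other way round than the residuals, which the monotonicity for
  exponent 1 forbids; so the residual is well defined ([argmin_residual_eq]).
- T is monotone because T(tau) = (tau / r) r ^ (alpha - 1), where r increases
  with tau, and so does the weight tau / r, again by monotonicity for
  exponent 1 ([Tmap_le]).
- A minimizer for (alpha, t) with residual r > 0 minimizes for
  (2, t r ^ (2 - alpha)), which exhibits a preimage of t under T and,
  for alpha > 1, shows that S and T are mutually inverse ([Tmap_surj], [TmapK],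
  [SmapK]).  The inverse of a nondecreasing bijection of the half-line is
  continuous ([nondecreasing_inverse_continuous]).

What remains is the existence of minimizers ([minimizers_nonempty]), by the
direct method.  Sublevel sets of the energy are norm bounded, by the
Poincare-type inequality and the equivalence of norms on the null set of J;
balls of a dual space are weak-star compact ([weak_star_compact_ball]); and
the energy is weak-star lower semicontinuous. *)

(** * Convexity of powers *)

(** For a > 1 this is Young's inequality for the product of y and x ^ (a - 1), with
exponents a and a / (a - 1), which stays valid at x = 0. *)
Lemma powR_tangent (R : realType) (a x y : R) : 1 <= a -> 0 <= x -> 0 <= y ->
  a^-1 * x `^ a + x `^ (a - 1) * (y - x) <= a^-1 * y `^ a.
Proof.
rewrite le_eqVlt => /predU1P[<- x0 y0|a1 x0 y0].
  by rewrite invr1 !mul1r subrr powRr0 mul1r !powRr1//; lra.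
have a0 : 0 < a by lra.
have b0 : 0 < a - 1 by lra.
have xx : x `^ (a - 1) * x = x `^ a by rewrite mulrC mulr_powRB1.
have q1 : a^-1 + (a / (a - 1))^-1 = 1 by field; lra.
have := @conjugate_powR R y (x `^ (a - 1)) a (a / (a - 1)) y0 (powR_ge0 _ _)
  a0 (divr_gt0 a0 b0) q1.
rewrite -powRrM (_ : (a - 1) * (a / (a - 1)) = a); last by field; lra.
rewrite mulrBr xx (_ : x `^ a / (a / (a - 1)) = x `^ a - a^-1 * x `^ a); last first.
  by field; lra.
by rewrite ![_ * y]mulrC ![_ / a]mulrC; lra.
Qed.

Lemma powR_continuous_at (R : realType) (p x : R) : 0 < x ->
  {for x, continuous (fun y : R => y `^ p)}.
Proof.
move=> x0; apply: differentiable_continuous; apply/derivable1_diffP.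
by have [] := is_derive1_powR p x0.
Qed.

(** * Changing the exponent *)

Section Residuals.
Context (R : realType) (X H : normedModType R).
Context (A : {linear X -> H}) (J : X -> \bar R) (f : H).
Context (J_ge0 : forall u : X, (0 <= J u)%E) (J_convex : econvex J)
  (J_homogeneous : abs_one_homogeneous J).

Implicit Types (u v w : X) (a c t e : R).

Local Notation d u := (`|A u - f|).
Local Notation argmin := (minimizers A J f).

Lemma J0 : J 0 = 0%E.
Proof. by rewrite -(scale0r (0 : X)) J_homogeneous normr0 mul0e. Qed.

(** Minimizers have finite J because the energy is finite at 0, so minimality can
be tested with real numbers only. *)
Lemma argminP a t u : 0 < t ->
  argmin a t u <-> exists2 j, J u = j%:E & forall w k, J w = k%:E ->
    a^-1 * d u `^ a + t * j <= a^-1 * d w `^ a + t * k.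
Proof.
move=> t0; split=> [umin|[j uj umin] w].
  have Ju_fin : J u \is a fin_num.
    move: (umin 0); rewrite /energy J0 mule0 adde0; have := J_ge0 u.
    by case: (J u) => [j||] //= _; rewrite gt0_muley ?lte_fin// addey.
  exists (fine (J u)); first by rewrite fineK.
  move=> w k wk; have := umin w.
  by rewrite /energy wk -(fineK Ju_fin) -!EFinM -!EFinD lee_fin.
rewrite /energy uj; have := J_ge0 w; case wk : (J w) => [k||] // _.
  by rewrite -!EFinM -!EFinD lee_fin; exact: umin.
by rewrite gt0_muley ?lte_fin// addey// leey.
Qed.

Lemma residual_convex u w e : 0 <= e <= 1 ->
  d (e *: w + (1 - e) *: u) <= e * d w + (1 - e) * d u.
Proof.
move=> /andP[e0 e1].
have -> : A (e *: w + (1 - e) *: u) - f = e *: (A w - f) + (1 - e) *: (A u - f).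
  rewrite linearD !linearZ/= !scalerBr addrACA -opprD -scalerDl.
  by rewrite (_ : e + (1 - e) = 1) ?scale1r//; ring.
by rewrite (le_trans (ler_normD _ _))// !normrZ !ger0_norm ?subr_ge0.
Qed.

Lemma J_segment u w j k e : 0 <= e <= 1 -> J u = j%:E -> J w = k%:E ->
  exists2 l, J (e *: w + (1 - e) *: u) = l%:E & l <= e * k + (1 - e) * j.
Proof.
move=> e01 uj wk; have := J_convex w u e01; have := J_ge0 (e *: w + (1 - e) *: u).
rewrite uj wk -!EFinM -EFinD; case: (J _) => [l||] //= _.
by rewrite lee_fin => le_l; exists l.
Qed.

(** Adding the two minimality inequalities gives J(v) <= J(u); the first one then
forces d(u) <= d(v). *)
Lemma argmin_residual_le a c t u v : 0 < a -> 0 < c -> c < t ->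
  argmin a c u -> argmin a t v -> d u <= d v.
Proof.
move=> a0 c0 ct /(argminP _ _ c0)[j uj umin].
move=> /(argminP _ _ (lt_trans c0 ct))[k vk vmin].
have uv := umin _ _ vk; have vu := vmin _ _ uj.
have kj : k <= j by rewrite -(ler_pM2l (_ : 0 < t - c)) ?subr_gt0//; nra.
have : a^-1 * d u `^ a <= a^-1 * d v `^ a by nra.
rewrite ler_pM2l ?invr_gt0// => le_pow.
rewrite leNgt; apply/negP => /(gt0_ltr_powR a0) lt_pow.
by move: (lt_pow (normr_ge0 _) (normr_ge0 _)); rewrite ltNge le_pow.
Qed.

(** The first-order condition.  Minimality of u is compared with the point
u + e (w - u): convexity and the tangent inequality bound the energy increment
by e g(e), with g continuous at 0 and g(0) the derivative in the direction of
w.  A negative g(0) would contradict minimality for small e. *)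
Lemma argmin_to_one a t u : 1 <= a -> 0 < t -> 0 < d u ->
  argmin a t u -> argmin 1 (t * d u `^ (1 - a)) u.
Proof.
move=> a1 t0 r0 /(argminP _ _ t0)[j uj umin].
have a0 : 0 < a by lra.
apply/argminP; first by rewrite mulr_gt0// powR_gt0.
exists j => // w k wk; set r := d u in r0 umin *; set q := d w.
have q0 : 0 <= q by rewrite normr_ge0.
have rr : r `^ (1 - a) * r `^ (a - 1) = 1.
  rewrite -powRD ?(gt_eqF r0) ?implybT//.
  by rewrite (_ : 1 - a + (a - 1) = 0) ?powRr0//; ring.
(* Dividing the first-order inequality by r ^ (a - 1) gives the claim. *)
suff slope : 0 <= r `^ (a - 1) * (q - r) + t * (k - j).
  have := mulr_ge0 (powR_ge0 r (1 - a)) slope.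
  rewrite mulrDr mulrA rr invr1 !mul1r !powRr1 ?(ltW r0)//; lra.
rewrite leNgt; apply/negP => slope_lt0.
pose g e := (r + e * (q - r)) `^ (a - 1) * (q - r) + t * (k - j).
have g_cont : {for 0, continuous g}.
  apply: cvgD; last exact: cvg_cst.
  apply: cvgM; last exact: cvg_cst.
  apply: (@continuous_comp _ _ _ (fun e => r + e * (q - r)) (fun x => x `^ (a - 1))).
    by apply: cvgD; [exact: cvg_cst|apply: cvgM; [exact: cvg_id|exact: cvg_cst]].
  by apply: powR_continuous_at; rewrite mul0r addr0.
have g0_lt0 : g 0 < 0 by rewrite /g mul0r addr0.
have g_right : g e @[e --> 0^'+] --> g 0 by exact: cvg_at_right_filter.
have [e [e0 e1 ge_lt0]] : exists e, [/\ 0 < e, e < 1 & g e < 0].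
  have : \forall e \near 0^'+, [/\ 0 < e, e < 1 & g e < 0].
    near=> e; split.
    - by near: e; exact: nbhs_right_gt.
    - by near: e; exact: nbhs_right_lt.
    - by near: e; exact: (cvgr_lt _ g_right _ g0_lt0).
  by move=> /filter_ex.
have e01 : 0 <= e <= 1 by rewrite !ltW.
have [l wl le_l] := J_segment e01 uj wk.
have := umin _ _ wl; have := residual_convex u w e01.
set s := d (_ + _); rewrite -/q -/r => le_s le_energy.
set x := r + e * (q - r) in ge_lt0.
have sx : s <= x by rewrite /x; lra.
have x0 : 0 <= x by exact: le_trans (normr_ge0 _) sx.
have s_pow : s `^ a <= x `^ a by rewrite ge0_ler_powR ?nnegrE ?normr_ge0 ?(ltW a0).
have tan := powR_tangent a1 x0 (ltW r0).
have le_pow : a^-1 * s `^ a <= a^-1 * x `^ a by rewrite ler_pM2l ?invr_gt0.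
have : e * g e < 0 by rewrite pmulr_rlt0.
rewrite /g -/x; rewrite (_ : r - x = - (e * (q - r))) in tan; last by rewrite /x; ring.
have : t * l <= t * (e * k + (1 - e) * j) by rewrite ler_pM2l.
nra.
Unshelve. all: by end_near.
Qed.

(** The tangent inequality at d(u) turns the linear lower bound valid for
exponent 1 into a lower bound for d(w) ^ a / a. *)
Lemma argmin_of_one a t u : 1 <= a -> 0 < t -> 0 < d u ->
  argmin 1 t u -> argmin a (t * d u `^ (a - 1)) u.
Proof.
move=> a1 t0 r0 /(argminP _ _ t0)[j uj umin].
have p0 : 0 < d u `^ (a - 1) by rewrite powR_gt0.
apply/argminP; first by rewrite mulr_gt0.
exists j => // w k wk.
have := umin _ _ wk; rewrite invr1 !mul1r !powRr1// => le1.
have tan := powR_tangent a1 (ltW r0) (normr_ge0 (A w - f)).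
have gap : 0 <= d w - d u + t * (k - j) by lra.
have := mulr_ge0 (ltW p0) gap; lra.
Qed.

(** Exponent 1 serves as an intermediate stop: the two weights multiply. *)
Lemma argmin_exponent a c t u : 1 <= a -> 1 <= c -> 0 < t -> 0 < d u ->
  argmin a t u -> argmin c (t * d u `^ (c - a)) u.
Proof.
move=> a1 c1 t0 r0 /(argmin_to_one a1 t0 r0).
move=> /(argmin_of_one c1 (mulr_gt0 t0 (powR_gt0 _ r0)) r0).
rewrite -mulrA -powRD ?(gt_eqF r0) ?implybT//.
by rewrite (_ : 1 - a + (c - 1) = c - a)//; ring.
Qed.

Context (f_not_null : forall u : X, A u = f -> J u <> 0%E).

(** If A u = f then J(u) > 0, and shrinking u to (1 - e) u lowers the J-term by an
amount linear in e while the fidelity grows only like e ^ a. *)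
Lemma argmin_residual_gt0 a t u : 1 < a -> 0 < t -> argmin a t u -> 0 < d u.
Proof.
move=> a1 t0 /(argminP _ _ t0)[j uj umin].
rewrite lt_def normr_ge0 andbT; apply/eqP => d0.
have Auf : A u = f by apply/eqP; rewrite -subr_eq0 -normr_eq0 d0.
have j0 : 0 < j.
  rewrite lt_def -!lee_fin -uj J_ge0 andbT; apply/eqP => j_eq0.
  by apply: (f_not_null Auf); rewrite uj j_eq0.
set K := a^-1 * `|f| `^ a.
have K0 : 0 <= K by rewrite mulr_ge0 ?powR_ge0 ?invr_ge0; lra.
have tj : 0 < t * j by exact: mulr_gt0.
(* The gain t j e beats the loss K e ^ a as soon as e ^ (a - 1) K < t j; the
   choice e ^ (a - 1) = c ensures this and also e <= 1. *)
pose c := t * j / (K + t * j).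
have c0 : 0 < c by rewrite divr_gt0//; lra.
have c1 : c <= 1 by rewrite ler_pdivrMr; lra.
pose e := c `^ (a - 1)^-1.
have e0 : 0 < e by exact: powR_gt0.
have ea : e `^ (a - 1) = c by rewrite -powRrM mulVf ?powRr1//; lra.
have e1 : e <= 1.
  apply: (@le_trans _ _ (1 `^ (a - 1)^-1)); last by rewrite powR1.
  by rewrite ge0_ler_powR ?nnegrE ?invr_ge0//; lra.
have e01 : 0 <= e <= 1 by rewrite ltW.
have [l wl le_l] := J_segment e01 uj J0.
have := umin _ _ wl; have := residual_convex u 0 e01.
rewrite d0 powR0; last by rewrite gt_eqF//; lra.
rewrite (linear0 A) sub0r normrN !mulr0 !addr0 add0r.
set s := d (_ + _) => le_s le_energy.
have s_pow : s `^ a <= (e * `|f|) `^ a.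
  have ef : 0 <= e * `|f| by rewrite mulr_ge0// ltW.
  have s0 : 0 <= s by exact: normr_ge0.
  by apply: ge0_ler_powR => //; rewrite ?nnegrE//; lra.
have : a^-1 * s `^ a <= e * c * K.
  rewrite -ea mulr_powRB1 ?(ltW e0)//; last by lra.
  by rewrite mulrCA -powRM ?(ltW e0)// ler_pM2l ?invr_gt0//; lra.
have : t * l <= t * ((1 - e) * j) by rewrite ler_pM2l//; lra.
have cK : c * K < t * j.
  rewrite /c mulrAC ltr_pdivrMr; last by lra.
  by rewrite ltr_pM2l//; lra.
have : e * (c * K) < e * (t * j) by rewrite ltr_pM2l.
lra.
Qed.

(** As minimizers for exponent 1, u and v have the weights t d(u) ^ (1 - a) and
t d(v) ^ (1 - a).  Since a > 1, the smaller residual carries the larger weight,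
against [argmin_residual_le]. *)
Lemma argmin_residual_eq a t u v : 1 < a -> 0 < t ->
  argmin a t u -> argmin a t v -> d u = d v.
Proof.
move=> a1 t0.
wlog : u v / d u < d v.
  move=> wlog umin vmin; have [uv|vu|//] := ltgtP (d u) (d v).
    exact: wlog.
  by apply/esym; exact: wlog.
move=> uv umin vmin; have u0 := argmin_residual_gt0 a1 t0 umin.
have v0 := argmin_residual_gt0 a1 t0 vmin.
have lt_weight : t * d v `^ (1 - a) < t * d u `^ (1 - a).
  rewrite ltr_pM2l// -[1 - a]opprB !powRN ltf_pV2 ?posrE ?powR_gt0//.
  by rewrite gt0_ltr_powR ?nnegrE ?subr_gt0.
have := argmin_residual_le ltr01 (mulr_gt0 t0 (powR_gt0 _ v0)) lt_weight
  (argmin_to_one (ltW a1) t0 v0 vmin) (argmin_to_one (ltW a1) t0 u0 umin).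
by rewrite leNgt uv.
Qed.

End Residuals.

(** * Continuous functionals and weak-star compactness *)

(** The index type is arbitrary, as needed for the type of continuous functionals:
classically it has a decidable equality, under which [proj_continuous] applies. *)
Lemma ptws_eval_continuous (I : Type) (T : topologicalType) (i : I) :
  continuous (fun g : {ptws I -> T} => g i).
Proof. exact: (@proj_continuous {classic I} (fun=> T) i). Qed.

Section InnerProduct.
Context (R : realType) (H : completeNormedModType R) (ip : {dot H for idfun}).
Context (H_hilbert : is_hilbert ip).

(** Cauchy-Schwarz, from the square of the norm of `|k| *: h - `|h| *: k. *)
Lemma ip_le_norm (h k : H) : ip h k <= `|h| * `|k|.
Proof.
have [->|h0] := eqVneq h 0; first by rewrite linear0l normr0 mul0r.
have [->|k0] := eqVneq k 0; first by rewrite linear0r normr0 mulr0.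
have hk : 0 < `|h| * `|k| by rewrite mulr_gt0 ?normr_gt0.
have kh : ip k h = ip h k by rewrite hermC expr0 mul1r.
have := sqr_ge0 (`| `|k| *: h - `|h| *: k |); rewrite H_hilbert.
rewrite linearBl !linearBr.
rewrite !linearZl_LR !linearZr_LR/= kh -!H_hilbert /GRing.scale/=.
move=> sq; rewrite -(ler_pM2l hk); lra.
Qed.

Lemma ip_functional (k : H) :
  exists2 L : {linear H -> R^o}, continuous L & forall h, L h = ip h k.
Proof.
have lin : linear (fun h : H => ip h k : R^o) by move=> c g h; rewrite linearPl.
pose L : {linear H -> R^o} :=
  HB.pack (fun h : H => ip h k : R^o) (GRing.isLinear.Build R H R^o _ _ lin).
exists L => //; apply: bounded_linear_continuous; apply/linear_boundedP.
have ip_abs h : `|ip h k| <= `|h| * `|k|.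
  rewrite ler_norml -[X in X && _]lerN2 opprK -linearNl -[`|h|]normrN.
  by rewrite !ip_le_norm// normrN ip_le_norm.
exists `|k|; split=> [|M kM h]; first exact: num_real.
by rewrite (le_trans (ip_abs h))// mulrC ler_wpM2r// ltW.
Qed.

End InnerProduct.

(** Pointwise limits of linear functionals are linear. *)
Lemma ptws_linear_closed (R : realType) (Y : normedModType R) (c : R) (y z : Y) :
  closed [set h : {ptws Y -> R^o} | h (c *: y + z) - (c *: h y + h z) = 0].
Proof.
apply: (@preimage_closed _ R (fun h : {ptws Y -> R^o} =>
  (h (c *: y + z) : R) - (c * (h y : R) + (h z : R))) [set x | x = 0]);
  last exact: closed_eq.
move=> h _.
have eval (x : Y) : (fun g : {ptws Y -> R^o} => (g x : R)) @ h --> (h x : R).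
  exact: ptws_eval_continuous.
have scaled := cvgM (cvg_cst c) (eval y).
exact: cvgB (eval (c *: y + z)) (cvgD (scaled _ _) (eval z)).
Qed.

Section WeakStar.
Context (R : realType) (Y X : normedModType R) (b : {bilinear X -> Y -> R^o}).

Context (X_dual : is_dual b).

(** The supremum defining the dual norm is finite because b u is continuous,
hence bounded on the unit ball. *)
Lemma dual_pairing_le (u : X) (y : Y) : `|b u y| <= `|u| * `|y|.
Proof.
have [->|y0] := eqVneq y 0; first by rewrite linear0r !normr0 mulr0.
have yn : 0 < `|y| by rewrite normr_gt0.
have [M bM] : exists M, forall z, `|b u z : R^o| <= M * `|z|.
  have /linear_bounded_continuous/linear_boundedP := @dual_continuous _ _ _ _ X_dual u.
  by move=> /filter_ex.
rewrite (dual_norm X_dual u).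
have -> : `|b u y| = `|b u (`|y|^-1 *: y)| * `|y|.
  rewrite linearZr_LR/= /GRing.scale/= normrM normfV normr_id mulrAC.
  by rewrite mulVf ?mul1r// gt_eqF.
rewrite ler_pM2r//; apply: ub_le_sup.
  exists `|M| => _ [z /= z1 <-]; rewrite (le_trans (bM z))//.
  by rewrite (le_trans (ler_norm _))// normrM normr_id ler_piMr.
exists (`|y|^-1 *: y) => //=.
by rewrite normrZ normfV normr_id mulVf// gt_eqF.
Qed.

(** The Banach-Alaoglu theorem.  In the pointwise topology, the functionals b u
with `|u| <= r lie in a product of segments, compact by Tychonoff.  A cluster
point there is linear and bounded by r, hence of the form b u with
`|u| <= r, and u is a cluster point in the weak-star topology. *)
Lemma weak_star_compact_ball (r : R) :
  compact ([set u | `|u| <= r] : set (weak_star b)).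
Proof.
move=> F FF Fball.
pose iota := (fun u : weak_star b => (fun y : Y => b u y) : {ptws Y -> R^o}).
have Kr : compact [set g : {ptws Y -> R^o} |
    forall y, `[- (r * `|y|), r * `|y|]%classic (g y)].
  have segment_c (y : Y) : compact (`[- (r * `|y|), r * `|y|]%classic : set R^o).
    exact: segment_compact.
  exact: tychonoff segment_c.
have [|g [gK gF]] := Kr (iota @ F) (fmap_proper_filter iota FF).
  rewrite nbhs_simpl/=.
  apply: filterS Fball => u /= ur y; rewrite in_itv/= -ler_norml.
  by rewrite (le_trans (dual_pairing_le _ _))// ler_wpM2r.
have [u0 /= u0r] : [set u : X | `|u| <= r] !=set0 by exact: filter_ex Fball.
have r0 : 0 <= r by exact: le_trans u0r.
have g_bound y : `|g y| <= r * `|y|.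
  by have := gK y; rewrite /= in_itv/= -ler_norml.
have g_lin : linear (g : Y -> R^o).
  move=> c y z; apply/eqP; rewrite -subr_eq0; apply/eqP.
  pose C := [set h : {ptws Y -> R^o} | h (c *: y + z) - (c *: h y + h z) = 0].
  have C_closed : closed C by exact: ptws_linear_closed.
  apply: C_closed => B gB; apply: gF gB.
  rewrite nbhs_simpl/=; apply: (@filterE _ F) => u.
  by rewrite /C /iota /= linearDr linearZr_LR subrr.
pose L : {linear Y -> R^o} :=
  HB.pack (g : Y -> R^o) (GRing.isLinear.Build R Y R^o _ g g_lin).
have L_cont : continuous L.
  apply: bounded_linear_continuous; apply/linear_boundedP.
  exists r; split=> [|M rM y]; first exact: num_real.
  by rewrite (le_trans (g_bound y))// ler_wpM2r// ltW.
have [u uL] := dual_surjective X_dual L_cont.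
have ug : iota u = g by apply/funext => y; exact: uL.
exists u; split.
  rewrite /= (dual_norm X_dual u); apply: ge_sup.
    by exists `|b u 0|; exists 0 => //=; rewrite normr0.
  move=> _ [y /= y1 <-]; rewrite uL (le_trans (g_bound y))//.
  by rewrite ler_piMr.
move=> S B FS; rewrite nbhsE => -[V [[G openG <-] Gu] VB].
have FiS : (iota @ F) (iota @` S).
  by rewrite nbhs_simpl/=; apply: (@filterS _ F) FS => v Sv; exists v.
have Gg : nbhs g G by apply: open_nbhs_nbhs; split=> //; rewrite -ug.
by have [_ [[v Sv <-] Gv]] := gF _ G FiS Gg; exists v; split; last exact: VB.
Qed.
End WeakStar.

(** * Existence of minimizers *)

Section Existence.
Context (R : realType) (Y X : normedModType R) (H : completeNormedModType R).
Context (b : {bilinear X -> Y -> R^o}) (ip : {dot H for idfun}).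
Context (A : {linear X -> H}) (J : X -> \bar R) (f : H).
Context (X_dual : is_dual b) (H_hilbert : is_hilbert ip).
Context (J_ge0 : forall u : X, (0 <= J u)%E) (J_lsc : weak_star_lsc b J)
  (J_homogeneous : abs_one_homogeneous J).
Context (A_weak : weak_star_to_weak_continuous b A).
Context (A_equiv :
  equivalent_on (nullset J) (fun u : X => `|A u|) (fun u : X => `|u|)).
Context (poincare : exists2 C : R, 0 < C &
     forall u : X, (`|u - PA A J (A u)|%:E <= C%:E * J u)%E).

Lemma weak_star_ip_continuous (k : H) :
  continuous (fun u : weak_star b => ip (A u) k : R^o).
Proof.
have [L L_cont LE] := ip_functional H_hilbert k.
have -> : (fun u : weak_star b => ip (A u) k : R^o) = L \o A.
  by apply/funext => u; rewrite /= LE.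
pose dual := {phi : {linear H -> R^o} | continuous phi}.
pose ev := fun v : weak H => (fun phi : dual => sval phi v) : {ptws dual -> R^o}.
pose phi : dual := exist _ L L_cont.
move=> u; apply: (@continuous_comp (weak_star b) (weak H) R^o A L).
  exact: A_weak.
apply: (@continuous_comp (weak H) _ R^o ev (fun g : {ptws dual -> R^o} => g phi)).
  exact: initial_continuous.
exact: ptws_eval_continuous.
Qed.

(** With k = A u - f, Cauchy-Schwarz bounds d(w) from below by ip (A w - f) k / `|k|,
which is weak-star continuous in w and equals d(u) at w = u. *)
Lemma residual_weak_star_lsc (u : weak_star b) (c : R) : c < `|A u - f| ->
  \forall w \near u, c < `|A w - f|.
Proof.
have [c0 _|c0 cu] := ltP c 0.
  by near=> w; rewrite (lt_le_trans c0).
set k := A u - f in cu *.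
have k0 : 0 < `|k| by exact: le_lt_trans cu.
have ip_gt : c * `|k| + ip f k < ip (A u) k.
  have -> : ip (A u) k = `|k| ^+ 2 + ip f k by rewrite H_hilbert -linearDl /k subrK.
  by rewrite ltrD2r expr2 ltr_pM2r.
near=> w.
rewrite -(ltr_pM2r k0); apply: (lt_le_trans _ (ip_le_norm H_hilbert _ _)).
rewrite linearBl ltrBrDr.
(* The remaining inequality is open in the continuous quantity ip (A w) k. *)
near: w; exact: (cvgr_gt _ (@weak_star_ip_continuous k u)).
Unshelve. all: by end_near.
Qed.

(** A minimizer v satisfies `|A v - g| <= `|g|, as 0 is a competitor, and on the
null set of J the norm of v is controlled by that of A v.  The default value 0
of the choice operator satisfies the bound as well. *)
Lemma PA_bound : exists2 K : R, 0 <= K & forall g : H, `|PA A J g| <= K * `|g|.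
Proof.
have [c [C [c0 _ equiv]]] := A_equiv.
exists (c^-1 * 2) => [|g]; first by rewrite mulr_ge0// invr_ge0 ltW.
rewrite /PA; case: xgetP => [v _ [v0 vmin]|_]; last first.
  by rewrite normr0 !mulr_ge0// invr_ge0 ltW.
have [cv _] := equiv v v0.
have := vmin 0 (J0 J_homogeneous); rewrite linear0 sub0r normrN => vg.
have Av : `|A v| <= `|A v - g| + `|g| by rewrite -{1}(subrK g (A v)) ler_normD.
rewrite -mulrA ler_pdivlMl//; lra.
Qed.

Context (a t : R) (a1 : 1 <= a) (t0 : 0 < t).

Local Notation E := (energy A J f a t).

(** The energy controls J(u), hence the distance from u to PA (A u), and d(u),
hence A u and PA (A u). *)
Lemma energy_sublevel_bounded (m : R) :
  exists r : R, forall u, (E u <= m%:E)%E -> `|u| <= r.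
Proof.
have [K K0 PAK] := PA_bound; have [C C0 poin] := poincare.
exists (C * (m / t) + K * (m + 1 + `|f|)) => u.
have := poin u; rewrite /energy; have := J_ge0 u.
case: (J u) => [j||] //; last by move=> _ _; rewrite gt0_muley ?lte_fin// addey.
rewrite -!EFinM -EFinD !lee_fin => j0 uPA le_m.
have a0 : 0 < a by exact: lt_le_trans a1.
have pow0 : 0 <= a^-1 * `|A u - f| `^ a by rewrite mulr_ge0 ?powR_ge0 ?invr_ge0 ?ltW.
have tj0 : 0 <= t * j by rewrite mulr_ge0 // ltW.
have jm : j <= m / t by rewrite ler_pdivlMr//; lra.
(* The tangent at 1 gives the linear bound d(u) <= m + 1. *)
have := powR_tangent a1 ler01 (normr_ge0 (A u - f)).
rewrite !powR1 mul1r mulr1 => tan.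
have ainv : 0 < a^-1 by rewrite invr_gt0.
have Au : `|A u| <= m + 1 + `|f|.
  have : `|A u| <= `|A u - f| + `|f| by rewrite -{1}(subrK f (A u)) ler_normD.
  lra.
have : `|u| <= `|u - PA A J (A u)| + `|PA A J (A u)|.
  by rewrite -{1}(subrK (PA A J (A u)) u) ler_normD.
have : C * j <= C * (m / t) by rewrite ler_pM2l.
have : K * `|A u| <= K * (m + 1 + `|f|) by rewrite ler_wpM2l.
have := PAK (A u); lra.
Qed.

Lemma fidelity_weak_star_lsc (u : weak_star b) (m : R) :
  m < a^-1 * `|A u - f| `^ a ->
  \forall w \near u, m < a^-1 * `|A w - f| `^ a.
Proof.
have a0 : 0 < a by exact: lt_le_trans a1.
have [m0 _|m0 mu] := ltP m 0.
  by near=> w; rewrite (lt_le_trans m0)// mulr_ge0 ?powR_ge0 ?invr_ge0 ?ltW.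
(* The threshold c solves c ^ a / a = m. *)
pose c := (a * m) `^ a^-1.
have am0 : 0 <= a * m by rewrite mulr_ge0// ltW.
have c_pow : c `^ a = a * m by rewrite -powRrM mulVf ?powRr1// gt_eqF.
have cu : c < `|A u - f|.
  rewrite ltNge; apply/negP => le_c.
  have : `|A u - f| `^ a <= c `^ a.
    by apply: ge0_ler_powR le_c; rewrite ?nnegrE ?powR_ge0// ltW.
  by rewrite c_pow leNgt -ltr_pdivlMl// mu.
near=> w.
have cw : c < `|A w - f| by near: w; exact: residual_weak_star_lsc.
rewrite ltr_pdivlMl// -c_pow gt0_ltr_powR ?nnegrE ?powR_ge0//.
Unshelve. all: by end_near.
Qed.

Lemma energy_weak_star_lsc (u : weak_star b) (m : R) :
  (m%:E < E u)%E -> \forall w \near u, (m%:E < E w)%E.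
Proof.
have a0 : 0 < a by exact: lt_le_trans a1.
have fid0 w : 0 <= a^-1 * `|A w - f| `^ a by rewrite mulr_ge0 ?powR_ge0 ?invr_ge0 ?ltW.
have lsc c : (c%:E < J u)%E -> \forall w \near u, (c%:E < J w)%E.
  by move=> cu; have [V uV VJ] := J_lsc cu; exact: filterS uV.
have energy_gt w x y : x < a^-1 * `|A w - f| `^ a -> (y%:E < J w)%E ->
    ((x + t * y)%:E < E w)%E.
  rewrite /energy; case: (J w) => [j||] // xw.
    by rewrite lte_fin => yj; rewrite -EFinM -EFinD lte_fin ltrD// ltr_pM2l.
  by move=> _; rewrite gt0_muley ?lte_fin// addey// ltry.
rewrite {1}/energy; have := J_ge0 u; case Ju : (J u) => [j||] // j0.
  rewrite -EFinM -EFinD lte_fin => mu.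
  (* The excess of the energy over m is split evenly between the two terms. *)
  pose e := (a^-1 * `|A u - f| `^ a + t * j - m) / 2.
  have e0 : 0 < e by rewrite /e; lra.
  near=> w.
  have -> : m = (a^-1 * `|A u - f| `^ a - e) + t * (j - e / t).
    rewrite mulrBr [t * (e / t)]mulrC divfK ?gt_eqF// /e; lra.
  apply: energy_gt; near: w.
    by apply: fidelity_weak_star_lsc; lra.
  by apply: lsc; rewrite Ju lte_fin gtrBl divr_gt0.
move=> _; near=> w.
have -> : m = -1 + t * ((m + 1) / t) by rewrite mulrC divfK ?gt_eqF//; ring.
apply: energy_gt; first by rewrite (lt_le_trans _ (fid0 w))// ltrN10.
by near: w; apply: lsc; rewrite Ju ltry.
Unshelve. all: by end_near.
Qed.

(** The sets of points whose energy does not exceed that of w, with w ranging over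
X, form a filter base because the energies are totally ordered.  One of them
lies in a ball, so they have a cluster point u; by lower semicontinuity
E(u) > E(w) is impossible for every w. *)
Lemma minimizers_nonempty : minimizers A J f a t !=set0.
Proof.
pose B w := [set u : weak_star b | (E u <= E w)%E].
pose F := filter_from [set: X] B.
have FF : ProperFilter F.
  apply: filter_from_proper => [|w _]; last by exists w; exact: lexx.
  apply: filter_from_filter => [|v w _ _]; first by exists 0.
  have [vw|wv] := leP (E v) (E w).
    by exists v => // u uv; split; [exact: uv|exact: le_trans uv vw].
  by exists w => // u uw; split; [exact: le_trans uw (ltW wv)|exact: uw].
have E0 : E 0 = (a^-1 * `|f| `^ a)%:E.
  by rewrite /energy (J0 J_homogeneous) mule0 adde0 linear0 sub0r normrN.
have [r ball_r] := energy_sublevel_bounded (a^-1 * `|f| `^ a).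
have Fr : F [set u | `|u| <= r].
  by exists 0 => // u; rewrite /B /= E0; exact: ball_r.
have [u [_ uF]] := @weak_star_compact_ball _ _ _ _ X_dual r F FF Fr.
exists u => w; rewrite leNgt; apply/negP => wu.
have Ew_fin : E w \is a fin_num.
  rewrite ge0_fin_numE; first exact: lt_le_trans wu (leey _).
  rewrite adde_ge0 ?mule_ge0 ?lee_fin ?mulr_ge0 ?powR_ge0 ?invr_ge0 ?(ltW t0)//.
  exact: le_trans ler01 a1.
have near_u : \forall v \near (u : weak_star b), (E w < E v)%E.
  by rewrite -(fineK Ew_fin); apply: energy_weak_star_lsc; rewrite fineK.
have [v [vw]] := uF (B w) _ (ex_intro2 _ _ w I (fun _ => id)) near_u.
by rewrite ltNge; move/negP; apply.
Qed.

End Existence.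

(** * The maps T and S *)

(** T is strictly increasing because it is injective, so the points S(t) - d and
S(t) + d are mapped strictly on either side of t; for y between their images,
S(y) stays within d of S(t). *)
Lemma nondecreasing_inverse_continuous (R : realType) (T S : R -> R) :
  {in `]0, +oo[ &, {homo T : x y / x <= y}} ->
  {in `]0, +oo[, forall t, S t \in `]0, +oo[} ->
  {in `]0, +oo[, cancel T S} -> {in `]0, +oo[, cancel S T} ->
  {in `]0, +oo[, continuous S}.
Proof.
move=> T_le S_pos TK SK t t0; have s0 := S_pos _ t0.
have T_lt : {in `]0, +oo[ &, {homo T : x y / x < y}}.
  move=> x y x0 y0; rewrite !lt_neqAle => /andP[xy /T_le ->//]; rewrite andbT.
  by apply: contraNneq xy => Txy; rewrite -(TK _ x0) -(TK _ y0) Txy.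
have S_lt x y : x \in `]0, +oo[ -> y \in `]0, +oo[ -> T x < y -> x <= S y.
  move=> x0 y0; apply: contraTT; rewrite -ltNge -leNgt => Sy.
  by rewrite -(SK _ y0) T_le// ?S_pos// ltW.
have lt_S x y : x \in `]0, +oo[ -> y \in `]0, +oo[ -> y < T x -> S y <= x.
  move=> x0 y0; apply: contraTT; rewrite -ltNge -leNgt => Sy.
  by rewrite -(SK _ y0) T_le// ?S_pos// ltW.
apply/(@cvgrPdist_le _ R) => e e0.
have s_gt0 : 0 < S t by move: s0; rewrite in_itv/= andbT.
(* The bound S(t) / 2 keeps S(t) - d inside the half-line. *)
pose d := Num.min e (S t / 2).
have d0 : 0 < d by rewrite lt_min e0 divr_gt0.
have de : d <= e by rewrite /d ge_min lexx.
have ds : d <= S t / 2 by rewrite /d ge_min lexx orbT.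
have lo : S t - d \in `]0, +oo[ by rewrite in_itv/= andbT; lra.
have hi : S t + d \in `]0, +oo[ by rewrite in_itv/= andbT; lra.
near=> y.
have y0 : y \in `]0, +oo[ by near: y; exact: near_in_itvoy.
rewrite ler_distlC; apply/andP; split.
  apply: (@le_trans _ _ (S t - d)); first by lra.
  apply: S_lt => //; near: y; apply: lt_nbhsr.
  by rewrite -{2}(SK _ t0) T_lt// gtrBl.
apply: (@le_trans _ _ (S t + d)); last by lra.
apply: lt_S => //; near: y; apply: lt_nbhsl.
by rewrite -{1}(SK _ t0) T_lt// ltrDl.
Unshelve. all: by end_near.
Qed.

Section ParameterMap.
Context (R : realType) (X H : normedModType R).
Context (A : {linear X -> H}) (J : X -> \bar R) (f : H).
Context (J_ge0 : forall u : X, (0 <= J u)%E) (J_convex : econvex J)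
  (J_homogeneous : abs_one_homogeneous J)
  (f_not_null : forall u : X, A u = f -> J u <> 0%E).
Context (argmin_ex : forall a t, 1 <= a -> 0 < t -> minimizers A J f a t !=set0).

Implicit Types (a c t : R).

Local Notation res := (residual A J f).

Lemma residual_argmin a t : 1 <= a -> 0 < t ->
  exists2 u, minimizers A J f a t u & res a t = `|A u - f|.
Proof.
move=> a1 t0; exists (xget 0 (minimizers A J f a t)) => //.
exact: xgetPex (argmin_ex a1 t0).
Qed.

Lemma residual_eq a t u : 1 < a -> 0 < t ->
  minimizers A J f a t u -> res a t = `|A u - f|.
Proof.
move=> a1 t0 umin; have [v vmin ->] := residual_argmin (ltW a1) t0.
exact: (argmin_residual_eq J_ge0 J_convex J_homogeneous f_not_null a1 t0 vmin umin).
Qed.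

Lemma residual_gt0 a t : 1 < a -> 0 < t -> 0 < res a t.
Proof.
move=> a1 t0; have [u umin ->] := residual_argmin (ltW a1) t0.
exact: (argmin_residual_gt0 J_ge0 J_convex J_homogeneous f_not_null a1 t0 umin).
Qed.

(** A minimizer for (a, t) with residual r is one for (c, t r ^ (c - a)) too, and
the residual does not depend on the minimizer. *)
Lemma residual_exchange a c t : 1 < a -> 1 < c -> 0 < t ->
  res c (t * res a t `^ (c - a)) = res a t.
Proof.
move=> a1 c1 t0; have [u umin r_eq] := residual_argmin (ltW a1) t0.
have r0 := residual_gt0 a1 t0.
rewrite [RHS]r_eq; apply: residual_eq => //; first by rewrite mulr_gt0// powR_gt0.
rewrite r_eq in r0 *.
exact: argmin_exponent (ltW a1) (ltW c1) t0 r0 umin.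
Qed.

Lemma residual_le t t' : 0 < t -> t <= t' -> res 2 t <= res 2 t'.
Proof.
move=> t0; rewrite le_eqVlt => /predU1P[->//|tt'].
have [u umin ->] := residual_argmin (ler1n R 2) t0.
have [v vmin ->] := residual_argmin (ler1n R 2) (lt_trans t0 tt').
exact: argmin_residual_le umin vmin.
Qed.

(** The weight t / R_2(t) is the one for which the minimizer for (2, t) minimizes
d + c J.  If it decreased, the residual could not increase, hence would stay
the same, and the weight would grow with t after all. *)
Lemma exact_weight_le t t' : 0 < t -> t <= t' ->
  t * res 2 t `^ (1 - 2) <= t' * res 2 t' `^ (1 - 2).
Proof.
move=> t0 tt'; have t'0 := lt_le_trans t0 tt'.
have r0 := residual_gt0 (ltr1n R 2) t0; have r'0 := residual_gt0 (ltr1n R 2) t'0.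
rewrite leNgt; apply/negP => lt_weight.
have le_res : res 2 t' <= res 2 t.
  have [u umin uE] := residual_argmin (ler1n R 2) t0.
  have [v vmin vE] := residual_argmin (ler1n R 2) t'0.
  rewrite uE vE in r0 r'0 lt_weight *.
  apply: argmin_residual_le lt_weight _ _ => //.
  - by rewrite mulr_gt0// powR_gt0.
  - exact: argmin_to_one (ler1n R 2) t'0 r'0 vmin.
  - exact: argmin_to_one (ler1n R 2) t0 r0 umin.
have res_eq : res 2 t' = res 2 t by apply/le_anti; rewrite le_res residual_le.
by move: lt_weight; rewrite res_eq ltr_pM2r ?powR_gt0// ltNge tt'.
Qed.

(** T(t) is the product of the weight t / R_2(t) and of R_2(t) ^ (a - 1), both
nondecreasing in t. *)
Lemma Tmap_le a t t' : 1 <= a -> 0 < t -> t <= t' ->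
  Tmap A J f a t <= Tmap A J f a t'.
Proof.
move=> a1 t0 tt'; have t'0 := lt_le_trans t0 tt'.
have factor s : 0 < s ->
    Tmap A J f a s = s * res 2 s `^ (1 - 2) * res 2 s `^ (a - 1).
  move=> s0; rewrite /Tmap -mulrA -powRD; first by congr (_ * _ `^ _); ring.
  by rewrite (gt_eqF (residual_gt0 (ltr1n R 2) s0)) implybT.
rewrite (factor t t0) (factor t' t'0).
have r0 := residual_gt0 (ltr1n R 2) t0; have r'0 := residual_gt0 (ltr1n R 2) t'0.
apply: ler_pM.
- by apply: mulr_ge0 (ltW t0) (powR_ge0 _ _).
- exact: powR_ge0.
- exact: exact_weight_le.
apply: ge0_ler_powR; [by rewrite subr_ge0|exact: ltW|exact: ltW|].
exact: residual_le.
Qed.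

(** A preimage of t is t r ^ (2 - a), where r > 0 is the residual of a minimizer
for (a, t): the exchange from a to 2 sends t there with the same minimizer,
and T multiplies by r ^ (a - 2) again. *)
Lemma Tmap_surj a : 1 <= a ->
  set_surj `]0, +oo[ (inexact_parameters A J f a) (Tmap A J f a).
Proof.
move=> a1 t [t0 [u umin]]; rewrite -normr_gt0 normr_id => u0.
have p0 : 0 < `|A u - f| `^ (2 - a) by rewrite powR_gt0.
exists (t * `|A u - f| `^ (2 - a)); first by rewrite /= in_itv/= andbT mulr_gt0.
have umin2 := argmin_exponent J_ge0 J_convex J_homogeneous a1 (ler1n R 2) t0 u0 umin.
rewrite /Tmap (residual_eq (ltr1n R 2) (mulr_gt0 t0 p0) umin2).
by rewrite -mulrA -[a - 2]opprB powRN mulfV ?mulr1// gt_eqF.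
Qed.

Lemma Tmap_gt0 a t : 0 < t -> 0 < Tmap A J f a t.
Proof. by move=> t0; rewrite mulr_gt0// powR_gt0// residual_gt0// ltr1n. Qed.

Lemma Smap_gt0 a t : 1 < a -> 0 < t -> 0 < Smap A J f a t.
Proof. by move=> a1 t0; rewrite mulr_gt0// powR_gt0// residual_gt0. Qed.

Lemma TmapK a t : 1 < a -> 0 < t -> Smap A J f a (Tmap A J f a t) = t.
Proof.
move=> a1 t0; rewrite /Smap /Tmap residual_exchange ?ltr1n//.
rewrite -mulrA -[2 - a]opprB powRN mulfV ?mulr1// gt_eqF// powR_gt0//.
by rewrite residual_gt0// ltr1n.
Qed.

Lemma SmapK a t : 1 < a -> 0 < t -> Tmap A J f a (Smap A J f a t) = t.
Proof.
move=> a1 t0; rewrite /Smap /Tmap residual_exchange ?ltr1n//.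
by rewrite -mulrA -[a - 2]opprB powRN mulfV ?mulr1// gt_eqF// powR_gt0// residual_gt0.
Qed.

Lemma argmin_well_defined a t : 1 < a -> 0 < t -> residual_well_defined A J f a t.
Proof.
move=> a1 t0; split=> [|u v umin vmin]; first exact: argmin_ex (ltW a1) t0.
by rewrite -(residual_eq a1 t0 umin) (residual_eq a1 t0 vmin).
Qed.

End ParameterMap.

Theorem theorem2p24 (R : realType)
  (Y X H : completeNormedModType R)
  (b : {bilinear X -> Y -> R^o}) (ip : {dot H for idfun})
  (A : {linear X -> H}) (J : X -> \bar R) (f : H) (alpha : R)
  (Y_separable : separable Y) (X_dual : is_dual b) (H_hilbert : is_hilbert ip)
  (A_bounded : exists M : R, forall u : X, `|A u| <= M * `|u|)
  (J_ge0 : forall u : X, (0 <= J u)%E)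
  (J_convex : econvex J)
  (J_proper : eproper J)
  (J_lsc : weak_star_lsc b J)
  (J_homogeneous : abs_one_homogeneous J)
  (f_not_null : forall u : X, A u = f -> J u <> 0%E)
  (A_norm : is_norm_on (nullset J) (fun u : X => `|A u|))
  (A_equiv : equivalent_on (nullset J) (fun u : X => `|A u|) (fun u : X => `|u|))
  (poincare : exists2 C : R, 0 < C &
     forall u : X, (`|u - PA A J (A u)|%:E <= C%:E * J u)%E)
  (A_weak : weak_star_to_weak_continuous b A)
  (alpha_ge1 : 1 <= alpha) :
  let T := Tmap A J f alpha in
  let S := Smap A J f alpha in
  [/\ forall tau : R, 0 < tau -> residual_well_defined A J f 2 tau,
      set_fun `]0, +oo[ `]0, +oo[ T,
      {in `]0, +oo[ &, {homo T : x y / x <= y}},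
      set_surj `]0, +oo[ (inexact_parameters A J f alpha) T &
      1 < alpha ->
      [/\ set_bij `]0, +oo[ `]0, +oo[ T,
          forall t : R, 0 < t -> residual_well_defined A J f alpha t,
          set_fun `]0, +oo[ `]0, +oo[ S,
          {in `]0, +oo[, cancel T S} /\ {in `]0, +oo[, cancel S T} &
          {in `]0, +oo[, continuous S}]].
Proof.
move=> T S.
have ex a t (a1 : 1 <= a) (t0 : 0 < t) : minimizers A J f a t !=set0.
  exact: (minimizers_nonempty f X_dual H_hilbert J_ge0 J_lsc J_homogeneous
    A_weak A_equiv poincare a1 t0).
have pos (x : R) : x \in `]0, +oo[ = (0 < x) by rewrite in_itv/= andbT.
have wd a t : 1 < a -> 0 < t -> residual_well_defined A J f a t.
  exact: (argmin_well_defined J_ge0 J_convex J_homogeneous f_not_null ex).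
have T_pos (t : R) : 0 < t -> 0 < T t.
  exact: (Tmap_gt0 J_ge0 J_convex J_homogeneous f_not_null ex).
have T_le : {in `]0, +oo[ &, {homo T : x y / x <= y}}.
  move=> x y; rewrite pos => x0 _.
  exact: (Tmap_le J_ge0 J_convex J_homogeneous f_not_null ex alpha_ge1 x0).
have T_surj : set_surj `]0, +oo[ (inexact_parameters A J f alpha) T.
  exact: (Tmap_surj J_ge0 J_convex J_homogeneous f_not_null ex alpha_ge1).
have S_pos : 1 < alpha -> forall t : R, 0 < t -> 0 < S t.
  by move=> a1 t; exact: (Smap_gt0 J_ge0 J_convex J_homogeneous f_not_null ex a1).
have TK : 1 < alpha -> {in `]0, +oo[, cancel T S}.
  move=> a1 t; rewrite pos.
  exact: (TmapK J_ge0 J_convex J_homogeneous f_not_null ex a1).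
have SK : 1 < alpha -> {in `]0, +oo[, cancel S T}.
  move=> a1 t; rewrite pos.
  exact: (SmapK J_ge0 J_convex J_homogeneous f_not_null ex a1).
(* What follows holds for any two maps with the properties above. *)
clearbody T S; split=> //.
- by move=> t; apply: wd; rewrite ltr1n.
- by move=> t; rewrite /= !pos; exact: T_pos.
move=> alpha_gt1; have {}S_pos := S_pos alpha_gt1.
have {}TK := TK alpha_gt1; have {}SK := SK alpha_gt1.
split=> //.
- split.
  + by move=> t; rewrite /= !pos; exact: T_pos.
  + move=> x y /set_mem x0 /set_mem y0 Txy.
    by rewrite -(TK _ x0) -(TK _ y0) Txy.
  + move=> t /= t0; exists (S t); last exact: SK.
    by move: t0; rewrite /= !pos; exact: S_pos.
- by move=> t; exact: wd.
- by move=> t; rewrite /= !pos; exact: S_pos.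
- apply: (nondecreasing_inverse_continuous T_le _ TK SK).
  by move=> t; rewrite !pos; exact: S_pos.
Qed.
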